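(* Let $R$ be an uncountable range set. If $(X,d)$ is a complete $\mathscr{N}(R,\omega_0)$-injective ultrametric space, then $(X,d)$ contains a subspace $F$ isometric to the $R$-Urysohn universal ultrametric space. Moreover, if $K$ is a compact subset of $X$ satisfying $d(K^2)\subseteq R$ (i.e. $d(x,y)\in R$ for all $x,y\in K$), then $F$ can be chosen so that $K\subseteq F$.
   Context: A range set is a subset $R\subseteq[0,\infty)$ with $0\in R$. An ultrametric space $(X,d)$ (i.e. $d(x,y)\le\max\{d(x,z),d(z,y)\}$) is $R$-valued if $d(x,y)\in R$ for all $x,y\in X$. $\mathscr{N}(R)=\mathscr{N}(R,\omega_0)$ is the class of all finite $R$-valued ultrametric spaces. For a class $\mathscr{C}$ of metric spaces, $(X,d)$ is $\mathscr{C}$-injective if it is non-empty and for all $(Y,e),(Z,h)\in\mathscr{C}$ and all isometric (distance-preserving) embeddings $\phi\colon Y\to Z$, $f\colon Y\to X$ there is an isometric embedding $F\colon Z\to X$ with $F\circ\phi=f$. If $R$ is uncountable, the $R$-Urysohn universal ultrametric space is the $R$-petaloid ultrametric space (known to exist and be unique up to isometry), defined as follows. A subset $E\subseteq[0,\infty)$ is semi-sporadic if $E=\{0\}\cup\{a_i\mid i\ge0\}$ for some strictly decreasing sequence $(a_i)_{i\ge 0}$ in $(0,\infty)$ with $a_i\to0$; it is tenuous if it is finite or semi-sporadic. $\mathbf{TEN}(R)$ is the set of all tenuous range sets contained in $R$. For $A\subseteq X$, $d(x,A)=\inf_{a\in A}d(x,a)$. A metric space $(X,d)$ is $R$-petaloid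 if it is an $R$-valued ultrametric space and there is a family $\{\Pi(X,S)\}_{S\in\mathbf{TEN}(R)}$ of subspaces of $X$ (an $R$-petal of $X$) such that: (P1) if $S\in\mathbf{TEN}(R)$ and $S\ne\{0\}$, then $(\Pi(X,S),d)$ is the $S$-Urysohn universal ultrametric space, i.e. a separable complete $\mathscr{N}(S)$-injective $S$-valued ultrametric space (unique up to isometry); (P2) $\bigcup_{S\in\mathbf{TEN}(R)}\Pi(X,S)=X$; (P3) $\Pi(X,S)\cap\Pi(X,T)=\Pi(X,S\cap T)$ for all $S,T\in\mathbf{TEN}(R)$; (P4) if $S,T\in\mathbf{TEN}(R)$ and $x\in\Pi(X,T)$, then $d(x,\Pi(X,S))\in\{0\}\cup(T\setminus S)$. *)

(* Defs.v *)
From HB Require Import structures.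
From mathcomp Require Import all_boot all_order all_algebra.
From mathcomp Require Import all_classical all_reals all_analysis.

Set Implicit Arguments.
Unset Strict Implicit.
Unset Printing Implicit Defensive.

Import Order.TTheory GRing.Theory Num.Theory.
Import numFieldNormedType.Exports.

Local Open Scope classical_set_scope.
Local Open Scope ring_scope.

(* [set_type A] already carries the pseudometric structure induced by the
   inclusion; this turns it into a metric space when the ambient space is one. *)
Section subspace_metric.
Context {K : realType} {X : metricType K} (A : set X).

Let sub_mdist (x y : set_type A) : K := mdist (set_val x) (set_val y).

Let sub_mdist_ge0 x y : 0 <= sub_mdist x y.
Proof. exact: mdist_ge0. Qed.

Let sub_mdist_positivity x y : sub_mdist x y = 0 -> x = y.
Proof. by move=> /mdist_positivity /val_inj. Qed.

Let sub_ballEmdist (x : set_type A) d :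
  ball x d = [set y | sub_mdist x y < d].
Proof.
rewrite -(initial_ballE (f := set_val)) ballEmdist.
by apply/seteqP; split.
Qed.

HB.instance Definition _ := @PseudoMetric_isMetric.Build K (set_type A)
  sub_mdist sub_mdist_ge0 sub_mdist_positivity sub_ballEmdist.

End subspace_metric.

Section range_sets.
Context {K : realType}.

Definition range_set (R : set K) := R 0 /\ R `<=` [set r | 0 <= r].

Definition semi_sporadic (E : set K) :=
  exists a : nat -> K,
    [/\ forall i, 0 < a i,
        forall i, a i.+1 < a i,
        a @ \oo --> (0 : K)
      & E = [set 0] `|` range a].

Definition tenuous (E : set K) := finite_set E \/ semi_sporadic E.

Definition TEN (R : set K) : set (set K) :=
  [set S | [/\ range_set S, tenuous S & S `<=` R]].

End range_sets.

Section metric_spaces.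
Context {K : realType}.
Implicit Types (X Y Z : metricType K) (R S T : set K).

Definition ultrametric X :=
  forall x y z : X, mdist x y <= Num.max (mdist x z) (mdist z y).

Definition valued R X := forall x y : X, R (mdist x y).

Definition isometric_embedding X Y (f : X -> Y) :=
  forall x y : X, mdist (f x) (f y) = mdist x y.

Definition isometric X Y :=
  exists f : X -> Y, isometric_embedding f /\ range f = [set: Y].

(* This is the axiom of the library's [completeType]. That structure is not
   used because it bundles a distinguished point. *)
Definition complete X :=
  forall F : set_system X, ProperFilter F -> cauchy F -> exists x : X, F --> x.

Definition separable X := exists D : set X, countable D /\ dense D.

Definition finite_valued_ultrametric R X :=
  [/\ finite_set [set: X], valued R X & ultrametric X].

Definition class_injective (C : metricType K -> Prop) X :=
  [set: X] !=set0 /\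
  forall (Y Z : metricType K) (phi : Y -> Z) (f : Y -> X),
    C Y -> C Z -> isometric_embedding phi -> isometric_embedding f ->
    exists F : Z -> X, isometric_embedding F /\ F \o phi = f.

(* Characterizes, up to isometry, the S-Urysohn universal ultrametric space
   for tenuous S. *)
Definition separable_urysohn S X :=
  [/\ separable X, complete X, class_injective (finite_valued_ultrametric S) X,
      valued S X & ultrametric X].

(* The infimum is taken in \bar K so that the distance to the empty set is +oo,
   whereas the real-valued [inf set0] is 0. In particular the last clause of
   [petal] forces all petals of a nonempty space, including that of {0}, to be
   nonempty. *)
Definition set_dist X (x : X) (A : set X) : \bar K :=
  ereal_inf [set (mdist x a)%:E | a in A].

(* Only the values of [Pi] at elements of [TEN R] matter. *)
Definition petal R X (Pi : set K -> set X) :=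
  [/\ forall S, TEN R S -> S <> [set 0] -> separable_urysohn S (set_type (Pi S)),
      \bigcup_(S in TEN R) Pi S = [set: X],
      forall S T, TEN R S -> TEN R T -> Pi S `&` Pi T = Pi (S `&` T)
    & forall S T (x : X), TEN R S -> TEN R T -> Pi T x ->
        (EFin @` ([set 0] `|` (T `\` S))) (set_dist x (Pi S))].

Definition petaloid R X :=
  [/\ valued R X, ultrametric X & exists Pi : set K -> set X, petal R Pi].

(* For uncountable R, the R-Urysohn universal ultrametric space is the
   R-petaloid space, which is unique up to isometry; being isometric to it thus
   means being isometric to some R-petaloid space. *)
Definition isometric_to_urysohn R X :=
  exists U : metricType K, petaloid R U /\ isometric X U.

End metric_spaces.

(* Main.v *)
Require Import Defs.
From HB Require Import structures.
From mathcomp Require Import all_boot all_order all_algebra.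
From mathcomp Require Import all_classical all_reals all_analysis.
Import Order.TTheory GRing.Theory Num.Theory.
Import numFieldNormedType.Exports.
Local Open Scope classical_set_scope.
Local Open Scope ring_scope.

Set Implicit Arguments.
Unset Strict Implicit.

(* A model of the R-petaloid space is the set of functions f : K -> nat whose
   support consists of positive elements of R and is finite above every
   positive threshold, the distance of f and g being the largest r with
   f r <> g r. Its petals consist of the functions supported in a given S.
   This model embeds in X. By injectivity, every closed r-ball of X (r in R)
   contains infinitely many points at mutual distance r; let c x r 0 = x,
   c x r 1, c x r 2, ... be such points around x. The point with code f is
   reached from a base point by moving from x to c x r (f r) for the successive
   elements r of the support of f, in decreasing order, and passing to the
   limit. The moves after r are shorter than r, so that the first difference of
   two codes decides the distance of their points.
   To catch a compact set C, the base point is taken in C, and the points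
   c x r n are taken in C as long as possible. A point k of C is then the end of
   the path that goes from x to the c x r n closest to k, where r = d(x, k):
   it remains in C, and the distances to k tend to 0 by compactness. *)

(** * Equilateral spaces and injectivity *)

(** The tag [r] lets the metric instance on ['I_n] depend on the side length. *)
Definition equilateral (K : realType) (r : {posnum K}) (n : nat) : Type := 'I_n.

Section equilateral_space.
Context {K : realType} (r : {posnum K}) (n : nat).

HB.instance Definition _ := Choice.copy (equilateral r n) 'I_n.

Definition equilateral_dist (i j : equilateral r n) : K :=
  if i == j then 0 else r%:num.

Let equilateral_distxx i : equilateral_dist i i = 0.
Proof. by rewrite /equilateral_dist eqxx. Qed.

Let equilateral_dist_eq0 i j : equilateral_dist i j = 0 -> i = j.
Proof.
by rewrite /equilateral_dist; case: eqVneq => // _ /eqP; rewrite gt_eqF.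
Qed.

Let equilateral_distC i j : equilateral_dist i j = equilateral_dist j i.
Proof. by rewrite /equilateral_dist eq_sym. Qed.

Let equilateral_ultra i j k :
  equilateral_dist i j <= Num.max (equilateral_dist i k) (equilateral_dist k j).
Proof.
rewrite /equilateral_dist; case: (eqVneq i j) => [_|ij].
  by rewrite le_max; case: ifP; rewrite ?lexx ?ge0.
by rewrite le_max; case: (eqVneq i k) => [<-|_];
  rewrite ?(negbTE ij) lexx ?orbT.
Qed.

Let equilateral_triangle j i k :
  equilateral_dist i k <= equilateral_dist i j + equilateral_dist j k.
Proof.
have d0 a b : 0 <= equilateral_dist a b.
  by rewrite /equilateral_dist; case: ifP; rewrite ?ge0.
by rewrite (le_trans (equilateral_ultra i k j))// ge_max lerDl lerDr !d0.
Qed.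

HB.instance Definition _ := isMetric.Build K (equilateral r n)
  equilateral_distxx equilateral_dist_eq0 equilateral_distC equilateral_triangle.

Lemma equilateralE (i j : equilateral r n) :
  mdist i j = if i == j then 0 else r%:num.
Proof. by []. Qed.

Lemma equilateral_finite_valued (R : set K) : R 0 -> R r%:num ->
  finite_valued_ultrametric R (equilateral r n).
Proof.
move=> R0 Rr; split; last exact: equilateral_ultra.
  exact: (@finite_finset 'I_n).
by move=> i j; rewrite equilateralE; case: ifP.
Qed.

End equilateral_space.

Section injective_extension.
Context {K : realType} {X : metricType K} (R : set K) (R_range : range_set R)
  (X_injective : class_injective (finite_valued_ultrametric R) X).

(** Injectivity is applied to the inclusion of an equilateral space on n points in one on n + 1
    points; y is the image of the extra point. *)
Lemma equilateral_extension (r : K) (s : seq X) : R r -> 0 < r ->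
  pairwise (fun x y => mdist x y == r) s ->
  exists y, all (fun x => mdist y x == r) s.
Proof.
move=> Rr r0 rs; have R0 : R 0 by case: R_range.
have [[x0 _] inj] := X_injective.
pose p := PosNum r0; pose n := size s.
pose phi (i : equilateral p n) : equilateral p n.+1 := widen_ord (leqnSn n) i.
pose f (i : equilateral p n) : X := nth x0 s i.
have phi_iso : isometric_embedding phi.
  by move=> i j; rewrite !equilateralE -!val_eqE.
have f_iso : isometric_embedding f.
  move=> i j; rewrite equilateralE /f; case: (eqVneq i j) => [->|ij].
    exact: mdistxx.
  have {ij} : (i != j :> nat) by rewrite val_eqE.
  have P := pairwiseP x0 rs.
  rewrite neq_ltn => /orP[ij|ji]; last rewrite metric_sym; apply/eqP/P => //.
  all: rewrite ?inE ?ltn_ord//.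
have [F [F_iso Ff]] := inj _ _ _ _ (@equilateral_finite_valued _ p n _ R0 Rr)
  (@equilateral_finite_valued _ p n.+1 _ R0 Rr) phi_iso f_iso.
exists (F ord_max); apply/allP => x /(nthP x0)[i ni <-].
have := congr1 (fun g => g (Ordinal ni)) Ff; rewrite /f /= => <-.
rewrite F_iso equilateralE ifF//; apply/negbTE; rewrite -val_eqE /=.
by rewrite neq_ltn ni orbT.
Qed.

End injective_extension.

(** * Compactness and representatives of balls *)

(** Two terms of the sequence within e / 2 of a cluster point are closer than e. *)
Lemma compact_not_separated (K : realType) (X : metricType K) (C : set X)
    (u : nat -> X) (e : K) : compact C -> (forall n, C (u n)) -> 0 < e ->
  (forall i j, (i < j)%N -> e <= mdist (u i) (u j)) -> False.
Proof.
move=> cC Cu e0 ue.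
have [|p [_ clp]] := cC (u @ \oo); first by exists 0%N => // n _; apply: Cu.
have Bp : nbhs p (ball p (e / 2)) by apply: nbhsx_ballx; rewrite divr_gt0.
have far i : exists2 j, (i < j)%N & ball p (e / 2) (u j).
  have [|_ [[j /= ij <-] pj]] := clp (u @` [set j | (i < j)%N]) _ _ Bp.
    by exists i.+1 => // j /= ij; exists j.
  by exists j.
have [i _ /ball_sym pi] := far 0%N; have [j ij pj] := far i.
have := ball_triangle pi pj.
by rewrite -splitr ballEmdist/= ltNge ue.
Qed.

Section representatives.
Context {K : realType} {X : metricType K} (R : set K) (R_range : range_set R)
  (X_ultrametric : ultrametric X)
  (X_injective : class_injective (finite_valued_ultrametric R) X).

(* [c x r] enumerates representatives of open r-balls in the closed r-ball
   around [x]. Choosing them greedily in [C] exhausts the balls that meet [C]: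
   otherwise [c x r] would be an infinite r-separated sequence in [C]. *)
Lemma ball_representatives (C : set X) : compact C ->
  exists c : X -> K -> nat -> X,
  [/\ forall x r, c x r 0%N = x,
      forall x r i j, R r -> 0 < r -> i != j -> mdist (c x r i) (c x r j) = r
    & forall x y, C x -> C y -> R (mdist x y) -> 0 < mdist x y ->
      exists n, C (c x (mdist x y) n) /\
                mdist (c x (mdist x y) n) y < mdist x y].
Proof.
move=> cC.
pose eqd r (s : seq X) := pairwise (fun x y => mdist x y == r) s.
pose new r (s : seq X) y := all (fun x => mdist y x == r) s.
(* [next (s, r)] prolongs an r-equilateral list s, by a point of C whenever some point of C fits. *)
have /choice[next nextP] : forall sr : seq X * K, exists y,
    R sr.2 -> 0 < sr.2 -> eqd sr.2 sr.1 ->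
    new sr.2 sr.1 y /\ ((exists2 z, C z & new sr.2 sr.1 z) -> C y).
  move=> [s r] /=.
  have [[y Cy ny]|nC] := pselect (exists2 y, C y & new r s y).
    by exists y.
  have [[[Rr r0] rs]|nR] := pselect ((R r /\ 0 < r) /\ eqd r s).
    have [y ny] := equilateral_extension R_range X_injective Rr r0 rs.
    by exists y.
  have [[x _] _] := X_injective.
  by exists x => Rr r0 rs; exfalso; apply: nR.
(* The lists grow at the head: [L x r n] runs from [c x r n] down to [c x r 0], which is x. *)
pose L x r n := iter n (fun s => next (s, r) :: s) [:: x].
pose c x r n := head x (L x r n).
have LS x r n : L x r n.+1 = c x r n.+1 :: L x r n by [].
have memL x r m n : (m <= n)%N -> c x r m \in L x r n.
  elim: n => [|n IHn].
    by rewrite leqn0 => /eqP ->; rewrite mem_head.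
  rewrite leq_eqVlt ltnS => /orP[/eqP ->|mn]; first by rewrite LS mem_head.
  by rewrite LS in_cons IHn ?orbT.
have eqL x r n : R r -> 0 < r -> eqd r (L x r n).
  move=> Rr r0; elim: n => // n IHn.
  rewrite /eqd LS /= -/(eqd _ _) IHn andbT.
  by have [] := nextP (L x r n, r) Rr r0 IHn.
have c_dist x r i j : R r -> 0 < r -> (i < j)%N ->
    mdist (c x r i) (c x r j) = r.
  move=> Rr r0; case: j => // j ij; apply/eqP; rewrite metric_sym.
  have [/allP + _] := nextP (L x r j, r) Rr r0 (eqL x r j Rr r0).
  by apply; apply: memL.
exists c; split=> //.
  move=> x r i j Rr r0; rewrite neq_ltn => /orP[ij|ji]; first exact: c_dist.
  by rewrite metric_sym c_dist.
move=> x y Cx Cy; set r := mdist x y => Rr r0.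
(* All representatives lie in the closed r-ball around x, as does y, so their distances to y are at
   most r. *)
have cy i : r <= mdist (c x r i) y -> mdist (c x r i) y = r.
  move=> ri; apply/eqP; rewrite eq_le ri andbT.
  case: i {ri} => [|i]; first exact: lexx.
  rewrite (le_trans (X_ultrametric _ _ x))// metric_sym.
  by rewrite (c_dist x r 0%N) ?maxxx.
(* While no earlier representative is closer than r to y, the point y of C is itself a candidate, so
   the greedy choice stays in C. *)
have Cc n : (forall i, (i < n)%N -> r <= mdist (c x r i) y) -> C (c x r n).
  case: n => // n ry.
  have [_] := nextP (L x r n, r) Rr r0 (eqL x r n Rr r0).
  apply; exists y => //=.
  elim: n ry => [|n IHn] ry.
    by rewrite /new /= andbT metric_sym (cy 0%N) ?ry.
  rewrite /new LS /= -/(new _ _ _) metric_sym cy ?ry// eqxx IHn// => i i_n.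
  by rewrite ry// ltnW.
have [near_y|noy] := pselect (exists n, mdist (c x r n) y < r).
  case: (ex_minnP near_y) => n ny n_min; exists n; split=> //.
  apply: Cc => i i_n; rewrite leNgt; apply/negP => /n_min.
  by rewrite leqNgt i_n.
exfalso; apply: (compact_not_separated cC _ r0 (u := c x r)) => [n|i j ij].
  by apply: Cc => i _; rewrite leNgt; apply/negP => ?; apply: noy; exists i.
by rewrite c_dist.
Qed.

End representatives.

Lemma seq_maximum (K : realType) (s : seq K) (x : K) : x \in s ->
  exists2 m, m \in s & forall y, y \in s -> y <= m.
Proof.
elim: s x => // a [_ x _|b s IHs x _].
  by exists a => [|y]; rewrite mem_seq1 // => /eqP ->.
have [m ms m_max] := IHs b (mem_head _ _).
have [am|/ltW ma] := leP a m.
  exists m => [|y]; first by rewrite inE ms orbT.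
  by rewrite inE => /orP[/eqP ->|/m_max].
exists a => [|y]; first exact: mem_head.
by rewrite inE => /orP[/eqP ->//|/m_max/le_trans->].
Qed.

(** * Codes and their supports *)

Section codes.
Context {K : realType}.
Implicit Types (R : set K) (f g : K -> nat) (r s e : K).

Definition sparse_code R f :=
  (forall r, f r != 0%N -> R r /\ 0 < r) /\
  (forall e, 0 < e -> finite_set [set r | e <= r /\ f r != 0%N]).

Lemma sparse_code0 R : sparse_code R (fun=> 0%N).
Proof. by split=> // e e0; apply: sub_finite_set (finite_set0 K) => r []. Qed.

Definition agree_above r f g := forall s, r < s -> f s = g s.

(** The increasing order makes a [foldr] treat the largest elements first. On an infinite set
    [fset_set] is empty, whence the hypotheses of [mem_support_above]. *)
Definition support_above f e : seq K :=
  sort <=%O (finmap.enum_fset (fset_set [set r | e <= r /\ f r != 0%N])).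

Lemma mem_support_above R f e r : sparse_code R f -> 0 < e ->
  (r \in support_above f e) = (e <= r) && (f r != 0%N).
Proof.
move=> [_ fin_f] e0; rewrite mem_sort in_fset_set; last exact: fin_f.
by apply/idP/andP => [/set_mem|/mem_set].
Qed.

Lemma support_above_sorted f e : sorted <%O (support_above f e).
Proof. by rewrite sort_lt_sorted finmap.fset_uniq. Qed.

(** Lowering the threshold adds elements in front, that is, at the end of a walk. *)
Lemma support_above_cat R f e e' : sparse_code R f -> 0 < e' -> e' <= e ->
  support_above f e' =
  [seq r <- support_above f e' | r < e] ++ support_above f e.
Proof.
move=> cf e'0 e'e; have e0 := lt_le_trans e'0 e'e.
apply: lt_sorted_eq; first exact: support_above_sorted.
  rewrite (sorted_pairwise lt_trans) pairwise_cat -!(sorted_pairwise lt_trans).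
  rewrite support_above_sorted (sorted_filter lt_trans) ?support_above_sorted//.
  rewrite !andbT; apply/allrelP => r s.
  rewrite mem_filter (mem_support_above _ cf e0) => /andP[re _] /andP[es _].
  exact: lt_le_trans es.
move=> r; rewrite mem_cat mem_filter !(mem_support_above _ cf)//.
case: (ltP r e) => [re|er]; rewrite ?orbF//=.
by rewrite (le_trans e'e er).
Qed.

(** Isolates the last move of a walk: the [nseq] of a boolean length is [[:: r]] or empty. *)
Lemma support_above_split R f r : sparse_code R f -> 0 < r ->
  support_above f r =
  nseq (f r != 0%N) r ++ [seq s <- support_above f r | r < s].
Proof.
move=> cf r0; apply: lt_sorted_eq; first exact: support_above_sorted.
  rewrite (sorted_pairwise lt_trans) pairwise_cat -!(sorted_pairwise lt_trans).
  rewrite (sorted_filter lt_trans) ?support_above_sorted//.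
  have -> : sorted <%O (nseq (f r != 0%N) r) by case: (f r != 0%N).
  rewrite !andbT; apply/allrelP => s t.
  by rewrite mem_nseq mem_filter => /andP[_ /eqP ->] /andP[].
move=> s; rewrite mem_cat mem_filter mem_nseq !(mem_support_above _ cf)//.
case: (ltgtP r s) => [_|_|<-] //=; rewrite ?andbF ?orbF//.
by case: (f r != 0%N).
Qed.

Lemma agree_above_support R f g r :
  sparse_code R f -> sparse_code R g -> 0 < r -> agree_above r f g ->
  [seq s <- support_above f r | r < s] = [seq s <- support_above g r | r < s].
Proof.
move=> cf cg r0 fg.
apply: lt_sorted_eq; rewrite ?(sorted_filter lt_trans) ?support_above_sorted//.
move=> s; rewrite !mem_filter.
rewrite (mem_support_above _ cf)// (mem_support_above _ cg)//.
by case: (ltP r s) => //= rs; rewrite fg.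
Qed.

(** At or above a place where f and g differ there are only finitely many such places, since each is
    in one of the two supports; r is the largest. *)
Lemma sparse_code_neq R f g : sparse_code R f -> sparse_code R g -> f <> g ->
  exists r, [/\ 0 < r, f r != g r & agree_above r f g].
Proof.
move=> cf cg fg.
have [r0 fgr0] : exists r, f r != g r.
  apply: contrapT => nfg; apply: fg; apply/funext => r; apply/eqP.
  by apply: contrapT => /negP ?; apply: nfg; exists r.
have r0_gt0 r : f r != g r -> 0 < r.
  case: (eqVneq (f r) 0%N) => [-> g0|/(proj1 cf)[]//].
  by have [] := proj1 cg r; rewrite // eq_sym.
pose D := [seq r <- support_above f r0 ++ support_above g r0 | f r != g r].
have memD r : r0 <= r -> f r != g r -> r \in D.
  move=> r0r fgr; rewrite mem_filter fgr mem_cat.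
  rewrite (mem_support_above _ cf) ?(mem_support_above _ cg) ?r0_gt0// r0r /=.
  by apply: contraNT fgr; rewrite negb_or !negbK => /andP[/eqP -> /eqP ->].
have DP r : r \in D -> f r != g r by rewrite mem_filter => /andP[].
have [m /DP fgm m_max] := seq_maximum (memD r0 (lexx _) fgr0).
exists m; split; rewrite ?r0_gt0// => s ms.
apply/eqP/negPn/negP => fgs; have := ms; rewrite ltNge => /negP; apply.
have r0m := m_max _ (memD _ (lexx _) fgr0).
by apply: m_max; apply: memD => //; rewrite (le_trans r0m)// ltW.
Qed.

End codes.

(** * Ultrametric estimates and limits of walks *)

Section ultrametric_facts.
Context {K : realType} {X : metricType K} (X_ultrametric : ultrametric X).

Lemma ultrametric_lt (x z y : X) (r : K) :
  mdist x z < r -> mdist z y < r -> mdist x y < r.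
Proof.
by move=> xz zy; rewrite (le_lt_trans (X_ultrametric x y z))// gt_max xz.
Qed.

(** This transfers a distance r from approximations with error less than r to the points
    approximated. *)
Lemma ultrametric_perturb (x x' y y' : X) (r : K) :
  mdist x x' < r -> mdist y y' < r -> mdist x' y' = r -> mdist x y = r.
Proof.
move=> xx' yy' x'y'; apply/eqP; rewrite eq_le; apply/andP; split.
  rewrite (le_trans (X_ultrametric x y x'))// ge_max (ltW xx').
  rewrite (le_trans (X_ultrametric x' y y'))// ge_max x'y' lexx.
  by rewrite metric_sym ltW.
rewrite leNgt; apply/negP => xy; move: x'y'; apply/eqP; rewrite lt_eqF//.
by apply: (ultrametric_lt _ yy'); apply: ultrametric_lt xy; rewrite metric_sym.
Qed.

End ultrametric_facts.

Section evaluation.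
Context {K : realType} {X : metricType K} (R : set K)
  (X_ultrametric : ultrametric X) (X_complete : complete X).
Context (c : X -> K -> nat -> X) (p : X) (c0 : forall x r, c x r 0%N = x)
  (c_dist : forall x r i j, R r -> 0 < r -> i != j ->
    mdist (c x r i) (c x r j) = r).

Definition walk (f : K -> nat) (x : X) (s : seq K) : X :=
  foldr (fun r y => c y r (f r)) x s.

Definition partial_value f e := walk f p (support_above f e).

Lemma eq_walk f g x s : {in s, f =1 g} -> walk f x s = walk g x s.
Proof.
elim: s => //= r s IHs fg; rewrite IHs ?fg ?mem_head// => t ts.
by rewrite fg// in_cons ts orbT.
Qed.

(** A move at r covers no distance if f r = 0, and otherwise the distance r < e between the
    representatives 0 and f r; the ultrametric inequality keeps the bound e along the walk. *)
Lemma walk_close f x s e : 0 < e -> {in s, forall r, [/\ R r, 0 < r & r < e]} ->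
  mdist (walk f x s) x < e.
Proof.
move=> e0; elim: s => [|r s IHs] /= sP; first by rewrite mdistxx.
have [|Rr r0 re] := sP r; first exact: mem_head.
apply: (ultrametric_lt X_ultrametric (z := walk f x s)); last first.
  by apply: IHs => t ts; apply: sP; rewrite in_cons ts orbT.
have [->|fr] := eqVneq (f r) 0%N; first by rewrite c0 mdistxx.
by rewrite -{2}(c0 (walk f x s) r) c_dist.
Qed.

(** The walk for e' prolongs the walk for e by moves shorter than e. *)
Lemma partial_value_close f e e' : sparse_code R f -> 0 < e' -> e' <= e ->
  mdist (partial_value f e') (partial_value f e) < e.
Proof.
move=> cf e'0 e'e; rewrite /partial_value (support_above_cat cf e'0 e'e).
rewrite /walk foldr_cat; apply: walk_close; first exact: lt_le_trans e'e.
move=> r; rewrite mem_filter (mem_support_above _ cf)// => /and3P[re _ fr].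
by have [] := proj1 cf r fr.
Qed.

(** Both walks are at the same point before treating r, then go to different representatives around
    it; not moving amounts to choosing the representative 0. *)
Lemma partial_value_dist f g r : sparse_code R f -> sparse_code R g -> 0 < r ->
  f r != g r -> agree_above r f g ->
  mdist (partial_value f r) (partial_value g r) = r.
Proof.
move=> cf cg r0 fgr fg.
have valueE h : sparse_code R h -> partial_value h r =
    c (walk h p [seq s <- support_above h r | r < s]) r (h r).
  move=> ch; rewrite /partial_value {1}(support_above_split ch r0).
  by case: (eqVneq (h r) 0%N) => //= ->; rewrite c0.
rewrite !valueE// -(agree_above_support cf cg r0 fg) (@eq_walk f g).
  apply: c_dist => //; case: (eqVneq (f r) 0%N) fgr => [->|fr _].
    by rewrite eq_sym => /(proj1 cg)[].
  by have [] := proj1 cf r fr.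
by move=> s; rewrite mem_filter => /andP[rs _]; apply: fg.
Qed.

(** The partial values at 1 / (n + 1) form a Cauchy sequence. The strict bound survives in the limit
    x, since x is within e of late terms. *)
Lemma value_exists f : sparse_code R f ->
  exists x, forall e, 0 < e -> mdist x (partial_value f e) < e.
Proof.
move=> cf; pose u n := partial_value f n.+1%:R^-1.
have u_near e : 0 < e ->
    \forall n \near \oo, mdist (partial_value f e) (u n) < e.
  move=> e0; have := near_infty_natSinv_lt (PosNum e0).
  apply: filterS => n /= ne.
  by rewrite metric_sym partial_value_close// ?invr_gt0// ltW.
have [|x ux] := X_complete (F := u @ \oo).
  apply: cauchy_exP => e e0; exists (partial_value f e).
  by rewrite ballEmdist; apply: u_near.
exists x => e e0.
have /cvg_ballP/(_ _ e0) xu := ux.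
near \oo => n.
apply: (ultrametric_lt X_ultrametric (z := u n)).
  have : ball x e (u n) by near: n.
  by rewrite ballEmdist.
by rewrite metric_sym; near: n; apply: u_near.
Unshelve. all: by end_near. Qed.

End evaluation.

(** * Coding by walks, with the compact set in the image *)

Section coding.
Context {K : realType} {X : metricType K} (R : set K) (R_range : range_set R)
  (X_ultrametric : ultrametric X) (X_complete : complete X)
  (X_injective : class_injective (finite_valued_ultrametric R) X).

Lemma coding (C : set X) : C !=set0 -> compact C ->
  (forall x y, C x -> C y -> R (mdist x y)) ->
  exists phi : (K -> nat) -> X,
    (forall f g r, sparse_code R f -> sparse_code R g -> 0 < r -> f r != g r ->
      agree_above r f g -> mdist (phi f) (phi g) = r) /\
    (forall k, C k -> exists2 f, sparse_code R f & phi f = k).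
Proof.
move=> [p Cp] cC RC.
have [c [c0 c_dist c_C]] :=
  ball_representatives R_range X_ultrametric X_injective cC.
have /choice[phi phiP] : forall f, exists x, sparse_code R f ->
    forall e, 0 < e -> mdist x (partial_value c p f e) < e.
  move=> f; have [cf|ncf] := pselect (sparse_code R f); last by exists p.
  have [x xP] := value_exists X_ultrametric X_complete p c0 c_dist cf.
  by exists x.
exists phi; split.
  move=> f g r cf cg r0 fgr fg.
  apply: (ultrametric_perturb X_ultrametric (phiP f cf r r0) (phiP g cg r r0)).
  exact: (partial_value_dist p c0 c_dist cf cg).
move=> k Ck.
(* [N x] selects the next point of the path from x towards k; the index 0 at k makes the path stay
   there. *)
have /choice[N NP] : forall x, exists n, if x == k then n = 0%N else
    C x -> C (c x (mdist x k) n) /\ mdist (c x (mdist x k) n) k < mdist x k.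
  move=> x; have [_|xk] := eqVneq x k; first by exists 0%N.
  have [Cx|nCx] := pselect (C x); last by exists 0%N.
  have [|n nP] := c_C _ _ Cx Ck (RC _ _ Cx Ck); first by rewrite mdist_gt0.
  by exists n.
pose y i := iter i (fun x => c x (mdist x k) (N x)) p.
pose rho i := mdist (y i) k.
have Cy i : C (y i).
  elim: i => //= i IHi; have := NP (y i).
  by case: eqP => [_ ->|_ /(_ IHi)[]//]; rewrite c0.
have rho_gt0 i : (0 < rho i) = (y i != k) by rewrite /rho mdist_gt0.
have rhoS i : 0 < rho i -> rho i.+1 < rho i.
  rewrite rho_gt0 => /negbTE yk; have := NP (y i).
  by rewrite yk => /(_ (Cy i))[].
have rho_le i j : (i <= j)%N -> rho j <= rho i.
  elim: j => [|j IHj]; first by rewrite leqn0 => /eqP ->.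
  rewrite leq_eqVlt => /orP[/eqP ->//|/IHj]; apply: le_trans.
  have [/rhoS/ltW//|] := boolP (0 < rho j).
  rewrite rho_gt0 negbK => /eqP yk; have := NP (y j).
  by rewrite yk eqxx /rho /= yk => ->; rewrite c0.
have rho_lt i j : (i < j)%N -> 0 < rho i -> rho j < rho i.
  by move=> ij /rhoS; apply: le_lt_trans; apply: rho_le.
have N_neq0 i : 0 < rho i -> N (y i) != 0%N.
  move=> /[dup] /rhoS; rewrite /rho /= => lt_rho _.
  by apply: contraTneq lt_rho => ->; rewrite c0 ltxx.
(* The code of k has the value [N (y i)] at [rho i] while this is positive, and 0 elsewhere. It is
   well defined because [rho] decreases strictly until it reaches 0. *)
have /choice[f fP] : forall r, exists n,
    (forall i, rho i = r -> 0 < r -> n = N (y i)) /\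
    (n != 0%N -> 0 < r /\ exists i, rho i = r).
  move=> r; have [[r0 [i ir]]|nr] := pselect (0 < r /\ exists i, rho i = r).
    exists (N (y i)); split=> [j jr _|_]; last by split=> //; exists i.
    congr (N (y _)).
    have [ij|ji|//] := ltngtP i j.
      by have := rho_lt _ _ ij; rewrite ir jr r0 ltxx => /(_ isT).
    by have := rho_lt _ _ ji; rewrite ir jr r0 ltxx => /(_ isT).
  exists 0%N; split=> // i ir r0; exfalso; apply: nr; split=> //.
  by exists i.
have f_rho i : 0 < rho i -> f (rho i) = N (y i) by move=> ?; apply (fP _).1.
(* The reversal puts the smallest radius first, as in [support_above]. *)
pose T i := [seq rho j | j <- rev (iota 0 i)].
have TS i : T i.+1 = rho i :: T i.
  by rewrite /T -addn1 iotaD rev_cat.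
have memT i r : reflect (exists2 j, (j < i)%N & r = rho j) (r \in T i).
  apply: (iffP mapP) => [[j]|[j ji ->]]; last first.
    by exists j; rewrite // mem_rev mem_iota.
  by rewrite mem_rev mem_iota => ji ->; exists j.
(* For the first i with [rho i] below e, the support of f above e consists of the earlier radii.
   Such an i exists: otherwise the decrease of [rho] would make [y] an e-separated sequence in C. *)
have T_support e : 0 < e -> exists2 i, rho i < e &
    (forall j, (j < i)%N -> e <= rho j) /\
    (forall r, r \in T i <-> e <= r /\ f r != 0%N).
  move=> e0.
  have [small|nsmall] := pselect (exists i, rho i < e); last first.
    exfalso; apply: (compact_not_separated cC Cy e0) => i j ij.
    have ei l : e <= rho l.
      by rewrite leNgt; apply/negP => ?; apply: nsmall; exists l.
    have /(rho_lt _ _ ij) ji := lt_le_trans e0 (ei i).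
    apply: le_trans (ei i) _; have := X_ultrametric (y i) k (y j).
    by rewrite -/(rho _) -/(rho _) le_max [X in _ || X]leNgt ji orbF.
  case: (ex_minnP small) => i ie i_min; exists i => //.
  have ge_e j : (j < i)%N -> e <= rho j.
    by move=> ji; rewrite leNgt; apply/negP => /i_min; rewrite leqNgt ji.
  split=> // r; split.
    move=> /memT[j /ge_e ej ->]; have rj0 := lt_le_trans e0 ej.
    by split=> //; rewrite f_rho// N_neq0.
  move=> [er /(fP r).2[r0 [j jr]]]; apply/memT; exists j => //.
  rewrite ltnNge; apply/negP => /rho_le.
  by rewrite jr leNgt (lt_le_trans ie er).
(* The walk prescribed by f retraces the path. *)
have T_walk i : (forall j, (j < i)%N -> 0 < rho j) ->
    sorted <%O (T i) /\ walk c f p (T i) = y i.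
  elim: i => // i IHi i0; have [|Ti wi] := IHi; first by move=> j /ltnW/i0.
  rewrite TS /= wi f_rho ?i0//; split=> //.
  rewrite (path_sortedE lt_trans) Ti andbT; apply/allP => r /memT[j ji ->].
  by apply: rho_lt => //; apply: i0; apply: ltnW.
have cf : sparse_code R f.
  split=> [r /(fP r).2[r0 [i ir]]|e e0].
    by split=> //; rewrite -ir; apply: RC.
  have [i _ [_ Ti]] := T_support e e0.
  by apply: sub_finite_set (finite_seq (T i)) => r /Ti.
exists f => //; apply/mdist_positivity/eqP; rewrite eq_le mdist_ge0 andbT.
(* If e = d(phi f, k) were positive, the partial value of f at e would be some [y i] closer than e
   to both [phi f] and k. *)
rewrite leNgt; apply/negP => e0; set e := mdist _ _ in e0.
have [i ie [ge_e Ti]] := T_support e e0.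
have [|T_sorted Ty] := T_walk i.
  by move=> j /ge_e; apply: lt_le_trans.
suff : e < e by rewrite ltxx.
rewrite {1}/e; apply: (ultrametric_lt X_ultrametric (z := y i)) => //.
rewrite -Ty; suff <- : support_above f e = T i by exact: phiP.
apply: lt_sorted_eq => //; first exact: support_above_sorted.
by move=> r; rewrite (mem_support_above _ cf e0); apply/andP/idP => /Ti.
Qed.

End coding.

(** * Tenuous sets *)

Section tenuous_sets.
Context {K : realType}.
Implicit Types E : set K.

(** This is the form of tenuousness that supports of codes satisfy directly; see [tenuousP]. *)
Definition locally_finite_off0 E :=
  forall e, 0 < e -> finite_set [set r | E r /\ e <= r].

Lemma tenuous_locally_finite E : tenuous E -> locally_finite_off0 E.
Proof.
move=> [finE|[a [a0 aS a_cvg ->]]] e e0.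
  by apply: sub_finite_set finE => r [].
have /cvgrPdist_lt/(_ _ e0)[N _ aN] := a_cvg.
apply: (@sub_finite_set _ _ (a @` `I_N)); last exact/finite_image/finite_II.
move=> r [[-> /=|[n _ <-] ean]]; first by rewrite leNgt e0.
exists n => //=; rewrite ltnNge; apply/negP => /aN /=.
by rewrite sub0r normrN gtr0_norm// ltNge ean.
Qed.

Lemma locally_finite_decreasing E (a : nat -> K) (e : K) :
  locally_finite_off0 E -> 0 < e -> (forall n, E (a n)) ->
  (forall i j, (i < j)%N -> a j < a i) -> exists n, a n < e.
Proof.
move=> finE e0 Ea a_decr; apply: contrapT => nae.
have ea n : e <= a n by rewrite leNgt; apply/negP => ?; apply: nae; exists n.
have inja : injective a.
  by move=> i j aij; have [/a_decr|/a_decr|//] := ltngtP i j; rewrite aij ltxx.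
apply: infinite_nat; have := finite_preimage (f := a) _ (finE e e0).
move=> /(_ (in2W inja)); apply: sub_finite_set => n _ /=.
by split.
Qed.

(** An infinite E has positive elements below every t > 0, and a largest one by local finiteness.
    Taking it repeatedly lists the positive elements of E in decreasing order. *)
Lemma tenuousP E : range_set E -> tenuous E <-> locally_finite_off0 E.
Proof.
move=> [E0 E_ge0]; split; first exact: tenuous_locally_finite.
move=> finE; have [|infE] := pselect (finite_set E); first by left.
have seqE e : 0 < e -> exists s : seq K, forall r, r \in s <-> E r /\ e <= r.
  move=> /finE/finite_seqP[s sE]; exists s => r.
  by rewrite -[_ /\ _]/([set r | E r /\ e <= r] r) sE.
have /choice[next nextP] : forall t, exists m, 0 < t ->
    [/\ E m, 0 < m, m < t & forall r, E r -> r < t -> r <= m].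
  move=> t; have [t0|] := ltP 0 t; last by exists 0.
  have [r [Er r0 rt]] : exists r, [/\ E r, 0 < r & r < t].
    apply: contrapT => nr; apply: infE.
    have : finite_set ([set 0] `|` [set r | E r /\ t <= r]).
      by rewrite finite_setU; split; [exact: finite_set1|exact: finE].
    apply: sub_finite_set => r Er.
    have [->|r_neq0] := eqVneq r 0; [by left|right; split=> //].
    rewrite leNgt; apply/negP => rt; apply: nr; exists r; split=> //.
    by rewrite lt_neqAle eq_sym r_neq0; exact: E_ge0.
  have [s sE] := seqE r r0.
  have [|m] := @seq_maximum _ [seq q <- s | q < t] r.
    by rewrite mem_filter rt; apply/sE.
  rewrite mem_filter => /andP[mt /sE[Em rm]] m_max; exists m => _; split=> //.
    exact: lt_le_trans rm.
  move=> q Eq qt; have [qr|rq] := ltP q r; first exact: le_trans (ltW qr) rm.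
  by apply: m_max; rewrite mem_filter qt; apply/sE.
have [s sE] := seqE 1 ltr01.
have [m ms m_max] := seq_maximum (mem_head 1 s).
(* The start m + 1 exceeds every element of E, because m bounds 1 and all elements that are at least
   1. As it need not lie in E, [a] omits it. *)
pose b n := iter n next (m + 1); pose a n := b n.+1.
have b0 n : 0 < b n.
  elim: n => [|n /nextP[]//].
  by rewrite /b /= ltr_wpDl// (le_trans ler01)// m_max ?mem_head.
have aE n : E (a n) by have [] := nextP _ (b0 n).
have aS n : a n.+1 < a n by have [] := nextP _ (b0 n.+1).
have a_decr i j : (i < j)%N -> a j < a i.
  elim: j => // j IHj; rewrite ltnS leq_eqVlt => /orP[/eqP ->//|/IHj].
  exact: lt_trans.
have a_small e : 0 < e -> exists n, a n < e.
  by move=> e0; exact: (locally_finite_decreasing finE).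
right; exists a; split=> //.
- by move=> n; exact: b0.
- apply/cvgrPdist_lt => e /a_small[N aN]; exists N => // n /= Nn.
  rewrite sub0r normrN gtr0_norm; last exact: b0.
  move: Nn; rewrite leq_eqVlt => /orP[/eqP <-//|/a_decr aNn].
  exact: lt_trans aN.
apply/seteqP; split=> [r Er|r [->//|[n _ <-]//]].
have [->|r_neq0] := eqVneq r 0; [by left|right].
have r0 : 0 < r by rewrite lt_neqAle eq_sym r_neq0; exact: E_ge0.
apply: contrapT => nar; have [n] := a_small r r0.
apply/negP; rewrite -leNgt ltW//.
(* An element r that is missed stays below every [b i]: being at most the next term and different
   from it, it is smaller. *)
rewrite -[a n]/(b n.+1); elim: n.+1 => [|i IHi].
  rewrite /b /=; have [r1|r1] := ltP r 1.
    by rewrite (lt_le_trans r1)// lerDr (le_trans ler01)// m_max ?mem_head.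
  rewrite (@le_lt_trans _ _ m) ?ltrDl// m_max// inE.
  by apply/orP; right; apply/sE.
have [_ _ _ /(_ r Er IHi)] := nextP _ (b0 i).
rewrite le_eqVlt => /orP[/eqP ri|//]; exfalso; apply: nar.
by exists i.
Qed.

End tenuous_sets.

(** * Spaces coded by sparse functions *)

(** Identifies T with the model over S through a bijection onto codes, without building a metric
    space of functions. It thus applies to subspaces of X and to petals alike. *)
Definition coded_by (K : realType) (S : set K) (T : metricType K)
    (gamma : T -> K -> nat) :=
  [/\ forall t, sparse_code S (gamma t),
      forall f, sparse_code S f -> exists t, gamma t = f,
      injective gamma
    & forall t u r, 0 < r -> gamma t r != gamma u r ->
        agree_above r (gamma t) (gamma u) -> mdist t u = r].

Section coded_space.
Context {K : realType} (S : set K) (S_range : range_set S) {T : metricType K}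
  (gamma : T -> K -> nat) (T_coded : coded_by S gamma).

Lemma coded_neq t u : t <> u -> 0 < mdist t u /\
  gamma t (mdist t u) != gamma u (mdist t u) /\
  agree_above (mdist t u) (gamma t) (gamma u).
Proof.
case: T_coded => code_g _ inj_g dist_g tu.
have g_neq : gamma t <> gamma u by move/inj_g.
have [r [r0 gr gtu]] := sparse_code_neq (code_g t) (code_g u) g_neq.
by rewrite (dist_g t u r r0 gr gtu).
Qed.

Lemma coded_lt t u e : 0 < e ->
  mdist t u < e <-> forall s, e <= s -> gamma t s = gamma u s.
Proof.
move=> e0; have [->|/eqP/coded_neq[r0 [gr gtu]]] := eqVneq t u.
  by rewrite mdistxx.
split=> [re s es|ge]; first exact/gtu/(lt_le_trans re).
by rewrite ltNge; apply/negP => /ge /eqP; apply/negP.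
Qed.

Lemma coded_le t u e : mdist t u <= e -> agree_above e (gamma t) (gamma u).
Proof.
have [->//|/eqP/coded_neq[r0 [gr gtu]] re s es] := eqVneq t u.
exact/gtu/(le_lt_trans re).
Qed.

Lemma coded_ultrametric : ultrametric T.
Proof.
move=> t u v; have [->|/eqP/coded_neq[r0 [gr _]]] := eqVneq t u.
  by rewrite mdistxx le_max mdist_ge0.
rewrite leNgt; apply/negP; rewrite gt_max => /andP[].
move=> /(coded_lt _ _ r0)/(_ _ (lexx _)) tv.
move=> /(coded_lt _ _ r0)/(_ _ (lexx _)) vu.
by rewrite tv vu eqxx in gr.
Qed.

Lemma coded_valued : valued S T.
Proof.
move=> t u; have [->|/eqP/coded_neq[r0 [gr _]]] := eqVneq t u.
  by rewrite mdistxx; case: S_range.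
case: T_coded => code_g _ _ _.
have [gt0|/(proj1 (code_g t))[]//] := eqVneq (gamma t (mdist t u)) 0%N.
by have [] := proj1 (code_g u) (mdist t u); rewrite // eq_sym -gt0.
Qed.

Lemma sparse_code_truncation f t e : (forall r, e <= r -> f r = gamma t r) ->
  (forall r, r < e -> f r = 0%N) -> sparse_code S f.
Proof.
case: T_coded => code_g _ _ _ ft f0; have [gt fin_gt] := code_g t; split.
  by move=> r; have [/f0 ->//|/ft ->] := ltP r e; apply: gt.
move=> d d0; apply: sub_finite_set (fin_gt d d0) => r /= [dr].
by have [/f0 ->//|/ft ->] := ltP r e.
Qed.

(** The limit code takes at r the value of any point whose ball of radius at most r is in the
    filter; two such balls meet, so the choice does not matter. *)
Lemma coded_complete : complete T.
Proof.
case: T_coded => code_g onto_g _ _ F FF /cauchyP cF.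
have /choice[c cP] : forall e, exists t, 0 < e -> F (ball t e).
  move=> e; have [e0|_] := ltP 0 e; first by have [t Ft] := cF e e0; exists t.
  by have [t _] := cF 1 ltr01; exists t.
pose f r := if 0 < r then gamma (c r) r else 0%N.
have fE e r : 0 < e -> e <= r -> f r = gamma (c e) r.
  move=> e0 er; have r0 := lt_le_trans e0 er; rewrite /f r0.
  suff /(coded_lt _ _ r0) : mdist (c r) (c e) < r by apply.
  have /filter_ex[t [ct et]] : F (ball (c r) r `&` ball (c e) e).
    by apply: filterI; apply: cP.
  move: ct et; rewrite !ballEmdist /= => ct et.
  apply: (ultrametric_lt coded_ultrametric ct); rewrite metric_sym.
  exact: lt_le_trans et er.
have cf : sparse_code S f.
  split=> [r|e e0].
    have [r0|r0] := ltP 0 r; last by rewrite /f ltNge r0.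
    by rewrite (fE r r)// => /(proj1 (code_g _))[].
  apply: sub_finite_set (proj2 (code_g (c e)) e e0) => r [er].
  by rewrite (fE e r).
have [t gt] := onto_g f cf; exists t; apply/fcvg_ballP => e e0.
apply: filterS (cP e e0) => u; rewrite !ballEmdist /=.
apply: (ultrametric_lt coded_ultrametric).
by apply/coded_lt => // r er; rewrite gt; apply: fE.
Qed.

(** Codes truncated at 1 / (n + 1) are dense as n varies. For fixed n they are countably many, being
    determined by their values at finitely many elements of S. *)
Lemma coded_separable : tenuous S -> separable T.
Proof.
case: T_coded => code_g onto_g inj_g _ /tenuous_locally_finite finS.
pose D n := [set t : T | forall r, r < n.+1%:R^-1 -> gamma t r = 0%N].
exists (\bigcup_n D n); split.
  apply: bigcup_countable => // n _.
  have n0 : 0 < n.+1%:R^-1 :> K by rewrite invr_gt0.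
  have /finite_seqP[s sE] := finS _ n0.
  apply/countable_injP; exists (fun t => pickle [seq gamma t r | r <- s]).
  move=> t u /set_mem Dt /set_mem Du /(pcan_inj pickleK) tu; apply: inj_g.
  apply/funext => r; have [rn|nr] := ltP r n.+1%:R^-1; first by rewrite Dt ?Du.
  have [rs|nrs] := boolP (r \in s); first by move/eq_in_map: tu; apply.
  have nS : ~ S r.
    by move=> Sr; move/negP: nrs; apply; have : [set` s] r by rewrite -sE.
  have g0 v : gamma v r = 0%N.
    by apply/eqP/negPn/negP => /(proj1 (code_g v))[].
  by rewrite !g0.
move=> O [t Ot] oO.
have /nbhs_ballP[e /= e0 teO] := open_nbhs_nbhs (conj oO Ot).
have [n _ /(_ n (leqnn n)) /= ne] := near_infty_natSinv_lt (PosNum e0).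
pose f r := if n.+1%:R^-1 <= r then gamma t r else 0%N.
have [u gu] : exists u, gamma u = f.
  apply/onto_g/(@sparse_code_truncation f t n.+1%:R^-1) => r nr;
    first by rewrite /f nr.
  by rewrite /f leNgt nr.
exists u; split.
  apply: teO; rewrite ballEmdist /=; apply/coded_lt => // s es.
  by rewrite gu /f (le_trans (ltW ne) es).
by exists n => // r nr; rewrite gu /f leNgt nr.
Qed.

(** Let w be a point of s closest to z, at distance r. The new code copies that of [h w] above r,
    takes at r a value n found in no code of [h x] for x in s, and vanishes below. *)
Lemma coded_extend (Z : metricType K) (h : Z -> T) (s : seq Z) (z : Z) :
  ultrametric Z -> valued S Z ->
  {in s &, forall x y, mdist (h x) (h y) = mdist x y} ->
  exists2 h' : Z -> T, {in s, h' =1 h} &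
    {in z :: s &, forall x y, mdist (h' x) (h' y) = mdist x y}.
Proof.
case: T_coded => code_g onto_g _ dist_g uZ vZ h_iso.
have [zs|zs] := boolP (z \in s).
  exists h => // x y xs ys; apply: h_iso.
    by move: xs; rewrite in_cons => /orP[/eqP ->|].
  by move: ys; rewrite in_cons => /orP[/eqP ->|].
suff [t tP] : exists t, {in s, forall x, mdist t (h x) = mdist z x}.
  have xz x : x \in s -> (x == z) = false.
    by move=> xs; apply: contraNF zs => /eqP <-.
  exists (fun x => if x == z then t else h x) => [x xs|x y].
    by rewrite xz.
  rewrite !in_cons => /orP[/eqP ->|xs] /orP[/eqP ->|ys].
  - by rewrite !mdistxx.
  - by rewrite eqxx xz// tP.
  - by rewrite eqxx xz// metric_sym tP// metric_sym.
  - by rewrite !xz// h_iso.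
have [->|[w ws w_min]] : s = [::] \/
    exists2 w, w \in s & forall x, x \in s -> mdist z w <= mdist z x.
  case: {h_iso zs} s => [|a s]; [by left|right].
  have [|_ /mapP[w ws ->] w_min] :=
    @seq_maximum _ [seq - mdist z x | x <- a :: s] (- mdist z a).
    exact: mem_head.
  by exists w => // x xs; rewrite -lerN2; apply/w_min/mapP; exists x.
  (* For empty s there is no constraint. *)
  by exists (h z).
pose r := mdist z w.
have r0 : 0 < r by rewrite mdist_gt0; apply: contraNneq zs => ->.
pose n := (\max_(x <- s) gamma (h x) r).+1.
have n_new x : x \in s -> n != gamma (h x) r.
  move=> xs; rewrite gtn_eqF// ltnS.
  exact: (leq_bigmax_seq (F := fun y => gamma (h y) r) x).
pose f q := if r < q then gamma (h w) q else if q == r then n else 0%N.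
have cf : sparse_code S f.
  have [gw fin_gw] := code_g (h w); split=> [q|e e0].
    rewrite /f; case: ltP => [_|_]; first exact: gw.
    by case: (eqVneq q r) => [-> _|_]; rewrite ?eqxx; split=> //; apply: vZ.
  have : finite_set ([set r] `|` [set q | e <= q /\ gamma (h w) q != 0%N]).
    by rewrite finite_setU; split; [exact: finite_set1|exact: fin_gw].
  apply: sub_finite_set => q /= [eq]; rewrite /f.
  by case: ltP => [_|_]; [right|case: (eqVneq q r) => [->|_]; [left|]].
have [t gt] := onto_g f cf; exists t => x xs.
(* Near w, minimality gives d(z, x) = r, and n makes r the first difference. Farther away, z and w
   have the same distance to x, and so do their images. *)
have [wx|wx] := leP (mdist w x) r.
  have -> : mdist z x = r.
    apply/eqP; rewrite eq_le w_min// andbT.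
    by rewrite (le_trans (uZ z x w))// ge_max lexx.
  apply: dist_g => //; first by rewrite gt /f ltxx eqxx n_new.
  move=> q rq; rewrite gt /f rq.
  by apply: (coded_le (e := r)) => //; rewrite h_iso.
have q0 := lt_trans r0 wx.
have -> : mdist z x = mdist w x.
  by apply: (ultrametric_perturb uZ (x' := w) (y' := x)); rewrite ?mdistxx.
apply: (ultrametric_perturb coded_ultrametric (x' := h w) (y' := h x)).
- apply/coded_lt => // q wq; rewrite gt /f ifT//.
  exact: lt_le_trans wq.
- by rewrite mdistxx.
- exact: h_iso.
Qed.

(** The map is forced on the image of [phi], where it is well defined because [phi] is injective;
    the points of Z are then added one by one. *)
Lemma coded_injective : class_injective (finite_valued_ultrametric S) T.
Proof.
case: (T_coded) => _ onto_g _ _.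
have [t0 _] := onto_g _ (sparse_code0 S).
split; first by exists t0.
move=> Y Z phi f [finY vY uY] [finZ vZ uZ] phi_iso f_iso.
have /finite_seqP[sY sYE] := finY; have /finite_seqP[sZ sZE] := finZ.
have memY y : y \in sY by have : [set: Y] y by []; rewrite sYE.
have memZ z : z \in sZ by have : [set: Z] z by []; rewrite sZE.
have /choice[h0 h0P] : forall z, exists t, forall y, phi y = z -> t = f y.
  move=> z; have [[y <-]|nz] := pselect (exists y, phi y = z); last first.
    by exists t0 => y yz; exfalso; apply: nz; exists y.
  exists (f y) => y' yy'; congr f; apply: mdist_positivity.
  by rewrite -phi_iso yy' mdistxx.
have h0E y : h0 (phi y) = f y by apply: h0P.
have h0_iso : {in [seq phi y | y <- sY] &,
    forall x y, mdist (h0 x) (h0 y) = mdist x y}.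
  by move=> _ _ /mapP[x _ ->] /mapP[y _ ->]; rewrite !h0E f_iso phi_iso.
have [h hE h_iso] : exists2 h : Z -> T, {in [seq phi y | y <- sY], h =1 h0} &
    {in sZ ++ [seq phi y | y <- sY] &,
      forall x y, mdist (h x) (h y) = mdist x y}.
  elim: sZ {sZE memZ} => [|z s [h hE h_iso]]; first by exists h0.
  have [h' h'E h'_iso] := coded_extend z uZ vZ h_iso; exists h' => // x xs.
  by rewrite h'E ?hE// mem_cat xs orbT.
exists h; split=> [x y|]; first by apply: h_iso; rewrite mem_cat memZ.
by apply/funext => y /=; rewrite hE ?h0E// map_f.
Qed.

Lemma coded_separable_urysohn : tenuous S -> separable_urysohn S T.
Proof.
move=> tS; split; [exact: coded_separable|exact: coded_complete
  |exact: coded_injective|exact: coded_valued|exact: coded_ultrametric].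
Qed.

End coded_space.

(** * Petals of a coded space *)

Section coded_petals.
Context {K : realType} (R : set K) (R_range : range_set R) {T : metricType K}
  (gamma : T -> K -> nat) (T_coded : coded_by R gamma).

Definition coded_petal (S : set K) : set T := [set t | sparse_code S (gamma t)].

Lemma coded_petal_coded S : S `<=` R ->
  coded_by S (fun t : set_type (coded_petal S) => gamma (set_val t)).
Proof.
case: T_coded => code_g onto_g inj_g dist_g SR; split.
- by move=> t; apply: (set_valP t).
- move=> f [fS fin_f]; have [t gt] : exists t, gamma t = f.
    by apply: onto_g; split=> // r /fS[/SR].
  have St : t \in coded_petal S by rewrite inE /coded_petal /= gt.
  by exists (exist _ t St).
- by move=> t u /inj_g /val_inj.
- by move=> t u r r0 gr gtu; exact: dist_g.
Qed.

(** A point lies in the petal of its own support with 0 added, which is tenuous by [tenuousP]. *)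
Lemma coded_petal_cover : \bigcup_(S in TEN R) coded_petal S = [set: T].
Proof.
apply/seteqP; split=> // t _; case: T_coded => code_g _ _ _.
have [gt fin_gt] := code_g t.
pose S : set K := [set r | r = 0 \/ gamma t r != 0%N].
have S_range : range_set S.
  split=> [|r [->|/gt[_ /ltW]//]] /=; [by left|exact: lexx].
exists S; last by split=> // r gr; split; [right|case: (gt r gr)].
split=> //; last by move=> r [->|/gt[]//]; case: R_range.
apply/tenuousP => // e e0; apply: sub_finite_set (fin_gt e e0) => r [].
by case=> [->|//]; rewrite leNgt e0.
Qed.

(** The infimum is attained at the point u whose code is that of t restricted to S. If u differs
    from t, the distance is the first place outside S where the code of t is nonzero, and it lies in
    U. *)
Lemma coded_petal_dist (S U : set K) (t : T) : TEN R S -> coded_petal U t ->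
  (EFin @` ([set 0] `|` (U `\` S))) (set_dist t (coded_petal S)).
Proof.
case: T_coded => code_g onto_g _ dist_g [S_range S_tenuous SR] Ut.
pose f r := if `[< S r >] then gamma t r else 0%N.
have cf : sparse_code S f.
  have [gt fin_gt] := code_g t; split=> [r|e e0].
    by rewrite /f; case: asboolP => // Sr /gt[].
  apply: sub_finite_set (fin_gt e e0) => r [er].
  by rewrite /f; case: asboolP.
have [u gu] : exists u, gamma u = f.
  by apply: onto_g; case: cf => fS fin_f; split=> // r /fS[/SR].
have uS : coded_petal S u by rewrite /coded_petal /= gu.
suff u_min v : coded_petal S v -> mdist t u <= mdist t v.
  exists (mdist t u); last first.
    apply/eqP; rewrite eq_le; apply/andP; split.
      by apply: le_ereal_inf_tmp => _ [v Sv <-]; rewrite lee_fin u_min.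
    by apply: ereal_inf_lbound; exists u.
  have [->|/eqP/(coded_neq T_coded)[r0 [gr _]]] := eqVneq t u.
    by left; rewrite /= mdistxx.
  right; move: gr; rewrite gu /f; case: asboolP => [_|nS gr].
    by rewrite eqxx.
  by split=> //; have [] := proj1 Ut _ gr.
(* A point v closer to t than u would share the nonzero value of t at d(t, u), a place outside S. *)
move=> [Sv _]; have [->|/eqP/(coded_neq T_coded)[r0 [gr _]]] := eqVneq t u.
  by rewrite mdistxx mdist_ge0.
rewrite leNgt; apply/negP => /(coded_lt T_coded _ _ r0)/(_ _ (lexx _)) tv.
move: gr; rewrite gu /f; case: asboolP => [_|nS]; first by rewrite eqxx.
by rewrite tv => /Sv[].
Qed.

Lemma coded_petaloid : petaloid R T.
Proof.
split; [exact: coded_valued T_coded|exact: coded_ultrametric T_coded|].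
exists coded_petal; split; [| exact: coded_petal_cover | |].
- move=> S [S_range S_tenuous SR] _.
  exact: coded_separable_urysohn (coded_petal_coded SR) S_tenuous.
- move=> S U _ _; apply/seteqP; split=> t.
    move=> [[gS fin_gt] [gU _]]; split=> // r gr.
    by have [? ?] := gS r gr; have [] := gU r gr.
  by move=> [g fin_gt]; split; split=> // r /g[[]].
- by move=> S U t TS _; apply: coded_petal_dist.
Qed.

End coded_petals.

(** * The petaloid subspace of X *)

Section image_of_coding.
Context {K : realType} {X : metricType K} (R : set K) (R_range : range_set R)
  (X_ultrametric : ultrametric X) (X_complete : complete X)
  (X_injective : class_injective (finite_valued_ultrametric R) X).

(** F is the image of the sparse codes. Distinct codes have images at positive distance, so choosing
    preimages inverts [phi] and makes F a coded space. *)
Lemma urysohn_subspace (C : set X) : C !=set0 -> compact C ->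
  (forall x y, C x -> C y -> R (mdist x y)) ->
  exists F : set X, isometric_to_urysohn R (set_type F) /\ C `<=` F.
Proof.
move=> C0 cC RC.
have [phi [phi_dist phi_C]] :=
  coding R_range X_ultrametric X_complete X_injective C0 cC RC.
exists [set phi f | f in [set f | sparse_code R f]]; split; last first.
  by move=> k /phi_C[f cf <-]; exists f.
set F := [set _ | _ in _].
have /choice[gamma gammaP] : forall x : set_type F, exists f,
    sparse_code R f /\ phi f = set_val x.
  by move=> x; have [f cf fx] := set_valP x; exists f.
exists (set_type F); split; last first.
  by exists id; split=> //; rewrite image_id.
apply: (@coded_petaloid _ _ R_range _ gamma); split.
- by move=> x; have [] := gammaP x.
- move=> f cf; have Fx : phi f \in F by rewrite inE; exists f.
  pose x : set_type F := SigSub Fx; exists x; have [cg /= gf] := gammaP x.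
  apply: contrapT => /(sparse_code_neq cg cf)[r [r0 gfr]].
  move=> /(phi_dist _ _ _ cg cf r0 gfr).
  by rewrite gf mdistxx => r00; rewrite r00 ltxx in r0.
- move=> x y gxy; apply: val_inj.
  by have [[_ + ] [_ +]] := (gammaP x, gammaP y); rewrite gxy => ->.
- move=> x y r r0 gr gxy; have [cx ex] := gammaP x; have [cy ey] := gammaP y.
  by rewrite -(phi_dist _ _ _ cx cy r0 gr gxy) ex ey.
Qed.

End image_of_coding.

Theorem theorem1p5 (K : realType) (R : set K) (X : metricType K)
    (R_range : range_set R) (R_uncountable : ~ countable R)
    (X_ultrametric : ultrametric X) (X_complete : complete X)
    (X_injective : class_injective (finite_valued_ultrametric R) X) :
  (exists F : set X, isometric_to_urysohn R (set_type F)) /\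
  (forall C : set X, compact C ->
     (forall x y : X, C x -> C y -> R (mdist x y)) ->
     exists F : set X, isometric_to_urysohn R (set_type F) /\ C `<=` F).
Proof.
have subspace := urysohn_subspace R_range X_ultrametric X_complete X_injective.
have exF : exists F : set X, isometric_to_urysohn R (set_type F).
  have [[x _] _] := X_injective.
  have [||_ _ -> ->|F [UF _]] := subspace [set x]; last by exists F.
  - by exists x.
  - exact: compact_set1.
  - by rewrite mdistxx; case: R_range.
split=> // C cC RC.
(* An empty C offers no base point, but lies in the subspace already found. *)
have [[x Cx]|C0] := pselect (C !=set0).
  by apply: subspace => //; exists x.
have [F UF] := exF; exists F; split=> // x Cx.
by exfalso; apply: C0; exists x.
Qed.
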